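(* Let $n\ge 1$ and let $X$ be a finite pure $n$-dimensional simplicial complex with connected links. Assume that $X$ is $(n+1)$-partite with sides $S_0,\dots,S_n$, and partite-regular in the following sense: for every $0\le i\le n$ there is a constant $K_i$ such that every vertex $\{v\}$ with $v\in S_i$ is contained in exactly $K_i$ $n$-dimensional simplices of $X$. Assume that there is a constant $0<\lambda<1$ such that for every $\tau\in\bigcup_{k=-1}^{n-2}X(k)$ the spectrum of the weighted random walk operator $(M')^+_{\tau,0}$ on the one-skeleton of $X_\tau$ (with weights induced by the homogeneous weight function of $X$) is contained in $[-1,\lambda]\cup\{1\}$. Then for all sets $U_0\subseteq S_0,\dots,U_n\subseteq S_n$, $$\left|\frac{|X(U_0,\dots,U_n)|}{|X(n)|}-\frac{|U_0|\cdots|U_n|}{|S_0|\cdots|S_n|}\right|\le C_n\lambda\min_{0\le i<j\le n}\sqrt{\frac{|U_i||U_j|}{|S_i||S_j|}},$$ where $$C_n=\sum_{k=0}^{n-1}n!\,\frac{(n+1-k)^{n-k}}{(n-k-1)!}\left((k+1)(k+2)^{n-k}-(k+1)^{n-k+1}\right).$$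
   Context: $X(k)$ denotes the set of simplices of $X$ with $k+1$ vertices, $X(-1)=\{\emptyset\}$; a vertex $v$ is identified with $\{v\}\in X(0)$. $X$ is pure $n$-dimensional if every simplex is contained in a simplex of $X(n)$. For $\tau\in X(k)$ the link $X_\tau$ is the complex with $\eta\in X_\tau(l)$ iff $\eta\in X(l)$ and $\tau\cup\eta\in X(k+l+1)$; $X_\emptyset=X$. ''Connected links'' means that for every $-1\le k\le n-2$ and every $\tau\in X(k)$ the one-skeleton of $X_\tau$ (the graph with vertices $X_\tau(0)$ and edges $X_\tau(1)$) is connected; in particular the one-skeleton of $X$ is connected. $X$ is $(n+1)$-partite with sides $S_0,\dots,S_n\subseteq X(0)$ if the $S_i$ are disjoint, $X(0)=\bigcup_i S_i$, and $|\sigma\cap S_i|=1$ for every $\sigma\in X(n)$ and every $0\le i\le n$. Homogeneous weight: for $-1\le k\le n$ and $\tau\in X(k)$, $m(\tau)=(n-k)!\,|\{\sigma\in X(n):\tau\subseteq\sigma\}|$. On the link, $m_\tau(\eta)=m(\tau\cup\eta)$. The weighted random walk operator $(M')^+_{\tau,0}$ acts on functions $\phi:X_\tau(0)\to\mathbb{R}$ by $$(M')^+_{\tau,0}\phi(v)=\sum_{u:\{u,v\}\in X_\tau(1)}\frac{m_\tau(\{u,v\})}{m_\tau(\{v\})}\phi(u).$$ For pairwise disjoint $U_0,\dots,U_n\subseteq X(0)$, $X(U_0,\dots,U_n)=\{\sigma\in X(n):|\sigma\cap U_i|=1\text{ for all }0\le i\le n\}$. *)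

(* Defs.v *)
From HB Require Import structures.
From mathcomp Require Import all_boot all_order all_algebra.
From mathcomp Require Import reals.

Set Implicit Arguments.
Unset Strict Implicit.
Unset Printing Implicit Defensive.

Import Order.TTheory GRing.Theory Num.Theory.
Local Open Scope ring_scope.

(* A finite simplicial complex is given by the set of its simplices, the empty
   simplex included, as sets of elements of a finite type V.  An element of V
   need not be a vertex of X. *)
Definition simplicial_complex (V : finType) (X : {set {set V}}) : Prop :=
  set0 \in X /\
  forall s t : {set V}, s \in X -> t \subset s -> t \in X.

(* Indexed by the number of vertices rather than by the dimension, so that the
   index -1 is not needed: [faces X k.+1] is X(k) and [faces X 0] is X(-1). *)
Definition faces (V : finType) (X : {set {set V}}) (d : nat) : {set {set V}} :=
  [set s in X | #|s| == d].

Definition pure (V : finType) (n : nat) (X : {set {set V}}) : Prop :=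
  forall s : {set V}, s \in X ->
    exists2 t : {set V}, t \in faces X n.+1 & s \subset t.

(* The cardinality condition contained in [faces] forces eta to be disjoint
   from tau. *)
Definition link (V : finType) (X : {set {set V}}) (tau : {set V}) :
    {set {set V}} :=
  [set eta in X | tau :|: eta \in faces X (#|tau| + #|eta|)].

Definition vertex (V : finType) (X : {set {set V}}) : finType :=
  {v : V | [set v] \in faces X 1}.

Definition edge (V : finType) (X : {set {set V}}) : rel (vertex X) :=
  fun u v => [set val u; val v] \in faces X 2.

(* -1 <= dim tau <= n - 2 reads #|tau| < n. *)
Definition connected_links (V : finType) (n : nat) (X : {set {set V}}) : Prop :=
  forall tau : {set V}, tau \in X -> (#|tau| < n)%N ->
    forall u v : vertex (link X tau), connect (@edge V (link X tau)) u v.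

Definition partite (V : finType) (n : nat) (X : {set {set V}})
    (S : 'I_n.+1 -> {set V}) : Prop :=
  [/\ forall i j : 'I_n.+1, i != j -> [disjoint S i & S j],
      [set v : V | [set v] \in faces X 1] = \bigcup_(i < n.+1) S i &
      forall (s : {set V}) (i : 'I_n.+1),
        s \in faces X n.+1 -> #|s :&: S i| = 1%N].

Definition partite_regular (V : finType) (n : nat) (X : {set {set V}})
    (S : 'I_n.+1 -> {set V}) : Prop :=
  forall i : 'I_n.+1, exists K : nat, forall v : V, v \in S i ->
    #|[set s in faces X n.+1 | v \in s]| = K.

(* With k = #|tau| - 1, the factor (n - k)! is (n.+1 - #|tau|)`!. *)
Definition weight (V : finType) (n : nat) (X : {set {set V}}) (tau : {set V}) :
    nat :=
  (n.+1 - #|tau|)`! * #|[set s in faces X n.+1 | tau \subset s]|.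

Definition link_weight (V : finType) (n : nat) (X : {set {set V}})
    (tau eta : {set V}) : nat :=
  weight n X (tau :|: eta).

Section RandomWalk.

Variables (R : realType) (V : finType) (n : nat).
Variables (X : {set {set V}}) (tau : {set V}).

Definition walk_fun (phi : {ffun vertex (link X tau) -> R^o}) :
    {ffun vertex (link X tau) -> R^o} :=
  [ffun v => \sum_(u | edge u v)
     (link_weight n X tau [set val u; val v])%:R
     / (link_weight n X tau [set val v])%:R * phi u].

Fact walk_fun_is_linear : linear walk_fun.
Proof.
move=> a f g; apply/ffunP => v; rewrite !ffunE scaler_sumr -big_split /=.
apply: eq_bigr => u _.
by rewrite !ffunE mulrDr [a *: f u]/(a * f u) [a *: (_ * _)]/(a * (_ * _)) mulrCA.
Qed.

HB.instance Definition _ :=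
  GRing.isLinear.Build R {ffun vertex (link X tau) -> R^o}
    {ffun vertex (link X tau) -> R^o} _ walk_fun walk_fun_is_linear.

Definition walk : 'End({ffun vertex (link X tau) -> R^o}) := linfun walk_fun.

End RandomWalk.

Definition transversal_faces (V : finType) (n : nat) (X : {set {set V}})
    (U : 'I_n.+1 -> {set V}) : {set {set V}} :=
  [set s in faces X n.+1 | [forall i, #|s :&: U i| == 1%N]].

(* Minimum of F over pairs i < j.  For 1 <= n the initial value is itself one
   of the F i j with i < j. *)
Definition min_pairs (R : realType) (n : nat)
    (F : 'I_n.+1 -> 'I_n.+1 -> R) : R :=
  \big[Num.min/F ord0 ord_max]_(p : 'I_n.+1 * 'I_n.+1 | (p.1 < p.2)%N)
     F p.1 p.2.

Definition mixing_const (R : realType) (n : nat) : R :=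
  \sum_(0 <= k < n)
     n`!%:R * ((n.+1 - k)%:R ^+ (n - k) / (n - k - 1)`!%:R)
     * (k.+1%:R * k.+2%:R ^+ (n - k) - k.+1%:R ^+ (n - k).+1).

(* Main.v *)
Require Import Defs.
From mathcomp Require Import all_boot all_order all_algebra.
From mathcomp Require Import reals.
From mathcomp Require Import complex ring lra.

Set Implicit Arguments.
Unset Strict Implicit.
Unset Printing Implicit Defensive.

Import Order.TTheory GRing.Theory Num.Theory.
Local Open Scope ring_scope.

(* Pick a top face uniformly at random; its vertices of color i are then uniform
   on S i.  In the link of a face tau, a function phi = f + h carried by two
   colors i and j and of mean zero is orthogonal to the constants, and the
   quadratic form of the walk at phi only sees the cross term f h; the spectral
   gap therefore bounds the covariance of f and h by (n - |tau|) lambda.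
   Conditioning on one more color at a time, from tau of dimension n - 1 down to
   the empty face, gives |Cov (f, F)| <= n^2 lambda |f| |F| for f depending on
   the color i and F on all the others.  Peeling the indicators of the U i off
   their product one by one, starting with the two colors p and q of a given
   pair, yields the bound (n + 1) n^2 lambda sqrt (P_p P_q), where P_i is the
   density of U i; and (n + 1) n^2 is at most the term k = 0 of C_n. *)

Lemma symmetric_rayleigh (R : rcfType) (m : nat) (A : 'M[R]_m) (l : R) :
  A^T = A -> (forall a, eigenvalue A a -> a <= l) ->
  forall x : 'rV[R]_m, (x *m A *m x^T) 0 0 <= l * (x *m x^T) 0 0.
Proof.
move=> A_sym eigA x; pose C : numClosedFieldType := R[i]%C.
pose io : {rmorphism R -> C} := real_complex R.
pose B : 'M[C]_m := map_mx io A.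
have io_real r : io r \is Num.real by apply/complex_realP; exists r.
have B_herm : B \is hermsymmx.
  apply: realsym_hermsym.
    apply/is_hermitianmxP; rewrite expr0 scale1r map_mx_id // /B.
    by rewrite map_trmx A_sym.
  by apply/mxOverP => i j; rewrite mxE io_real.
have D_real := hermitian_spectral_diag_real B_herm.
move: (spectral_unitarymx B) (orthomx_spectralP (hermitian_normalmx B_herm)).
move: D_real; set P := spectralmx B; set D := spectral_diag B => D_real P_unit.
rewrite (invmx_unitary P_unit) => BE.
have D_le i : D 0 i <= io l.
  have DiE : D 0 i = io (complex.Re (D 0 i)).
    by rewrite [RHS]RRe_real // (mxOverP D_real).
  rewrite DiE lecR; apply: eigA; rewrite -(eigenvalue_map io) -DiE.
  apply/eigenvalueP; exists (row i P).
    rewrite -/B BE -!row_mul !mulmxA (unitarymxP P_unit) mul1mx.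
    by rewrite row_mul row_diag_mx -scalemxAl -rowE.
  apply/eqP => Pi0; have := row_mul i P (P ^t*)%sesqui.
  rewrite (unitarymxP P_unit) Pi0 mul0mx => /rowP/(_ i).
  by rewrite !mxE eqxx => /eqP; rewrite oner_eq0.
pose X : 'rV[C]_m := map_mx io x; pose y := X *m (P ^t*)%sesqui.
have XT : map_mx io x^T = (X ^t*)%sesqui.
  by apply/matrixP => i j; rewrite !mxE; apply: esym; apply/CrealP; exact: io_real.
have yC : (y ^t*)%sesqui = P *m (X ^t*)%sesqui.
  by rewrite /y trmx_mul map_mxM /= trmxCK.
have -> : (x *m A *m x^T) 0 0 <= l * (x *m x^T) 0 0 =
   (io ((x *m A *m x^T) 0 0) <= io (l * (x *m x^T) 0 0)) by rewrite lecR.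
have -> : io ((x *m A *m x^T) 0 0) = \sum_i D 0 i * `|y 0 i| ^+ 2.
  transitivity ((map_mx io (x *m A *m x^T)) 0 0); first by rewrite [RHS]mxE.
  rewrite !map_mxM /= XT -/X -/B BE !mulmxA -(mulmxA _ P) -yC -/y.
  rewrite mul_mx_diag mxE; apply: eq_bigr => i _.
  by rewrite !mxE normCK mulrAC mulrC mulrA.
have -> : io (l * (x *m x^T) 0 0) = \sum_i io l * `|y 0 i| ^+ 2.
  rewrite rmorphM /=.
  have -> : io ((x *m x^T) 0 0) = (map_mx io (x *m x^T)) 0 0 by rewrite [RHS]mxE.
  rewrite map_mxM XT -/X -mulr_sumr; congr (_ * _).
  have -> : X *m (X ^t*)%sesqui = y *m (y ^t*)%sesqui.
    by rewrite yC mulmxA mulmxKtV.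
  by rewrite mxE; apply: eq_bigr => i _; rewrite !mxE normCK.
by apply: ler_sum => i _; apply: ler_wpM2r; rewrite ?exprn_ge0.
Qed.

Lemma harmonic_constant (R : realDomainType) (T : finType) (c : T -> T -> R)
    (w y : T -> R) :
  (forall u v, c u v = c v u) -> (forall u v, 0 <= c u v) ->
  (forall v, w v = \sum_u c v u) ->
  (forall u v, connect (fun u v => c u v != 0) u v) ->
  (forall v, \sum_u c v u * y u = w v * y v) ->
  forall u v, y u = y v.
Proof.
move=> c_sym c_ge0 wE conn y_harm.
have dirichlet : \sum_v \sum_u c v u * (y v - y u) ^+ 2 = 0.
  have -> : \sum_v \sum_u c v u * (y v - y u) ^+ 2 =
    (\sum_v \sum_u c v u * y v ^+ 2 + \sum_v \sum_u c v u * y u ^+ 2)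
     - (\sum_v \sum_u c v u * y u * y v) *+ 2.
    rewrite -sumrMnl -big_split -sumrB; apply: eq_bigr => v _ /=.
    by rewrite -sumrMnl -big_split -sumrB; apply: eq_bigr => u _ /=; ring.
  rewrite [X in _ + X - _]exchange_big /=.
  under [X in _ + X - _]eq_bigr do under eq_bigr do rewrite c_sym.
  rewrite -mulr2n -mulrnBl -sumrB big1 ?mul0rn // => v _.
  by rewrite -!mulr_suml y_harm -wE; ring.
have edge_eq u v : c u v != 0 -> y u = y v.
  move=> cuv; have c2 i j : 0 <= c i j * (y i - y j) ^+ 2.
    by rewrite mulr_ge0 ?sqr_ge0.
  have /eqP := dirichlet; rewrite psumr_eq0 => [|i _]; last exact: sumr_ge0.
  move/allP/(_ u (mem_index_enum u)); rewrite /= psumr_eq0 //.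
  move/allP/(_ v (mem_index_enum v)).
  by rewrite /= mulf_eq0 (negPf cuv) sqrf_eq0 subr_eq0 => /eqP.
move=> u v; have /connectP[p] := conn u v.
elim: p u => [|x p IHp] u /=; first by move=> _ ->.
by case/andP => /edge_eq -> /IHp.
Qed.

Lemma sum_enum_val (V : nmodType) (T : finType) (F : T -> V) :
  \sum_(i < #|T|) F (enum_val i) = \sum_v F v.
Proof. by rewrite -(big_enum_val (A := T)); apply: eq_bigl. Qed.

(* Subtracting the projection on the constants moves the eigenvalue 1 to 0 and
   leaves the other eigenvalues alone, so that all of them are at most l. *)
Lemma reversible_gap (R : rcfType) (T : finType) (c : T -> T -> R)
    (w : T -> R) (l : R) :
  (forall u v, c u v = c v u) -> (forall u v, 0 <= c u v) ->
  (forall v, w v = \sum_u c v u) -> (forall v, 0 < w v) ->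
  (forall u v, connect (fun u v => c u v != 0) u v) -> 0 <= l ->
  (forall (a : R) (y : T -> R), (exists v, y v != 0) ->
     (forall v, \sum_u c v u * y u = a * (w v * y v)) -> a <= l \/ a = 1) ->
  forall phi : T -> R, \sum_v w v * phi v = 0 ->
  \sum_v \sum_u c v u * phi v * phi u <= l * \sum_v w v * phi v ^+ 2.
Proof.
move=> c_sym c_ge0 wE w_gt0 conn l_ge0 eig phi phi0.
pose s v := Num.sqrt (w v); pose W := \sum_v w v.
have s2 v : s v ^+ 2 = w v by rewrite sqr_sqrtr // ltW.
have s_gt0 v : 0 < s v by rewrite sqrtr_gt0.
have s_neq0 v : s v != 0 by rewrite gt_eqF.
have W_ge0 : 0 <= W by apply: sumr_ge0 => v _; exact: ltW.
pose K u v := c u v / (s u * s v) - s u * s v / W.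
pose A : 'M[R]_#|T| := \matrix_(i, j) K (enum_val i) (enum_val j).
have A_sym : A^T = A.
  by apply/matrixP => i j; rewrite !mxE /K c_sym ![s (enum_val j) * _]mulrC.
have eigA a : eigenvalue A a -> a <= l.
  case/eigenvalueP => x xA x_neq0; rewrite leNgt; apply/negP => l_lt_a.
  pose y v := x 0 (enum_rank v) / s v.
  have xE v : x 0 (enum_rank v) = s v * y v by rewrite /y mulrCA divff ?mulr1.
  have y_neq0 : exists v, y v != 0.
    apply/existsP; apply: contraR x_neq0 => /existsPn y0; apply/eqP/rowP => i.
    by rewrite mxE -(enum_valK i) xE (eqP (negbNE (y0 _))) mulr0.
  have W_neq0 : W != 0.
    have [v _] := y_neq0; rewrite gt_eqF // /W (bigD1 v) //=.
    by rewrite ltr_pwDl // sumr_ge0 // => u _; apply: ltW.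
  have yE v : \sum_u c v u * y u - w v * (\sum_u w u * y u) / W =
      a * (w v * y v).
    have /rowP/(_ (enum_rank v)) := xA; rewrite !mxE xE.
    under eq_bigr do rewrite mxE.
    under eq_bigr => j _ do rewrite -{1}(enum_valK j) xE enum_rankK.
    rewrite (sum_enum_val (fun u => s u * y u * K u v)) => E.
    have -> : a * (w v * y v) = s v * (a * (s v * y v)) by rewrite -s2; ring.
    rewrite -E !(mulr_sumr, mulr_suml) -sumrB; apply: eq_bigr => u _.
    rewrite /K c_sym -!s2; field.
    by rewrite W_neq0 !s_neq0.
  have mean0 : \sum_u w u * y u = 0.
    set S := \sum_u _; have : a * S = 0.
      rewrite /S mulr_sumr; under eq_bigr do rewrite -yE.
      rewrite sumrB exchange_big /=.
      under eq_bigr do (rewrite -mulr_suml; under eq_bigr do rewrite c_sym).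
      under eq_bigr do rewrite -wE.
      by rewrite -!mulr_suml -/S -/W [W * S]mulrC mulfK // subrr.
    move/eqP; rewrite mulf_eq0 gt_eqF ?(le_lt_trans l_ge0) //=.
    by move/eqP.
  have y_eig v : \sum_u c v u * y u = a * (w v * y v).
    by rewrite -yE mean0 mulr0 mul0r subr0.
  have [a_le|a1] := eig a y y_neq0 y_eig; first by rewrite ltNge a_le in l_lt_a.
  have y_const := harmonic_constant c_sym c_ge0 wE conn
    (fun v => etrans (y_eig v) (etrans (congr1 ( *%R^~ _) a1) (mul1r _))).
  have [v yv_neq0] := y_neq0.
  move/eqP: mean0; under eq_bigr do rewrite (y_const _ v).
  by rewrite -mulr_suml -/W mulf_eq0 (negPf W_neq0) (negPf yv_neq0).
pose x : 'rV[R]_#|T| := \row_i (s (enum_val i) * phi (enum_val i)).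
have := symmetric_rayleigh A_sym eigA x; rewrite [leLHS]mxE [X in _ * X]mxE.
have -> : \sum_j x 0 j * x^T j 0 = \sum_v w v * phi v ^+ 2.
  rewrite -[RHS]sum_enum_val; apply: eq_bigr => i _.
  by rewrite !mxE -s2; ring.
congr (_ <= _).
transitivity (\sum_v \sum_u (c v u * phi v * phi u -
    (w v * phi v) * (w u * phi u) / W)).
  rewrite -[RHS]sum_enum_val; apply: eq_bigr => i _.
  rewrite !mxE mulr_suml -[RHS]sum_enum_val; apply: eq_bigr => j _.
  rewrite !mxE /K -!s2 mulrBr mulrBl; congr (_ - _); last by ring.
  by rewrite c_sym; field; rewrite !s_neq0.
under eq_bigr do rewrite sumrB.
rewrite sumrB -[RHS]subr0; congr (_ - _); apply: big1 => v _.
by rewrite -mulr_suml -mulr_sumr phi0 mulr0 mul0r.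
Qed.

Section LinkSums.

Variables (R : realType) (V : finType) (n : nat) (X : {set {set V}}).
Hypotheses (X_complex : simplicial_complex X) (X_pure : pure n X).

Definition top_faces (tau : {set V}) : {set {set V}} :=
  [set s in faces X n.+1 | tau \subset s].

Lemma top_facesP (tau s : {set V}) :
  reflect [/\ s \in X, #|s| = n.+1 & tau \subset s] (s \in top_faces tau).
Proof.
rewrite !inE -andbA.
by apply: (iffP and3P) => -[? /eqP ? ?]; split => //; apply/eqP.
Qed.

Lemma top_faces_gt0 tau : tau \in X -> (0 < #|top_faces tau|)%N.
Proof.
move=> /X_pure[s s_top tau_s]; apply/card_gt0P; exists s.
by rewrite inE s_top.
Qed.

Lemma link_vertexE tau v :
  ([set v] \in faces (link X tau) 1) = (v \notin tau) && (tau :|: [set v] \in X).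
Proof.
rewrite !inE !cards1 eqxx andbT setUC cardsU1.
case: (boolP (v |: tau \in X)) => [vtX | _]; last by rewrite !andbF.
have -> : [set v] \in X.
  by apply: (X_complex.2 _ _ vtX); rewrite sub1set setU11.
by rewrite addn1; case: (v \in tau); rewrite /= ?add1n ?eqxx // add0n eqn_leq ltnn andbF.
Qed.

Lemma link_edgeE tau (u v : vertex (link X tau)) :
  edge u v = (val u \notin tau :|: [set val v]) &&
    (tau :|: [set val v] :|: [set val u] \in X).
Proof.
have /andP[vt vtX] : (val v \notin tau) && (tau :|: [set val v] \in X).
  by rewrite -link_vertexE (valP v).
rewrite /edge !inE cards2 -setUA (setUC [set val v]) negb_or.
case: (boolP (val u == val v)) => [_ | uv /=]; first by rewrite !andbF.
rewrite eqxx !andbT addn2.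
have -> : #|tau :|: [set val u; val v]| = ((val u \notin tau) + #|tau|.+1)%N.
  rewrite setUC -setUA cardsU1 !inE (negPf uv) /=; congr (_ + _)%N.
  by rewrite cardsU1 vt.
case: (boolP (tau :|: _ \in X)) => [uvtX | _]; last by rewrite !andbF.
have -> : [set val u; val v] \in X.
  by apply: (X_complex.2 _ _ uvtX); rewrite subsetUr.
by case: (val u \in tau); rewrite ?eqxx //= add0n eqn_leq ltnn andbF.
Qed.

Lemma sum_top_facesU (tau : {set V}) (H : V -> {set V} -> R) :
  \sum_(v | [set v] \in faces (link X tau) 1)
     \sum_(s in top_faces (tau :|: [set v])) H v s
  = \sum_(s in top_faces tau) \sum_(v in s :\: tau) H v s.
Proof.
rewrite (exchange_big_dep (mem (top_faces tau))) /=; last first.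
  move=> v s _ /top_facesP[sX s_card tvs]; apply/top_facesP; split => //.
  by apply: subset_trans tvs; rewrite subsetUl.
apply: eq_bigr => s /top_facesP[sX s_card ts]; apply: eq_bigl => v.
rewrite link_vertexE !inE sX s_card eqxx subUset ts sub1set /=.
case: (v \in tau) => //=; case: (boolP (v \in s)) => [vs | _]; rewrite ?andbF //.
by rewrite andbT (X_complex.2 _ _ sX) // subUset ts sub1set.
Qed.

Lemma sum_link_vertices (tau : {set V}) (H : V -> {set V} -> R) :
  \sum_(v : vertex (link X tau))
     \sum_(s in top_faces (tau :|: [set val v])) H (val v) s
  = \sum_(s in top_faces tau) \sum_(v in s :\: tau) H v s.
Proof.
rewrite -sum_top_facesU.
exact: (esym (big_sub (fun v => [set v] \in faces (link X tau) 1) (fun v =>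
  \sum_(s in top_faces (tau :|: [set v])) H v s))).
Qed.

Lemma sum_link_neighbours (tau : {set V}) (v : vertex (link X tau)) (g : V -> R) :
  \sum_(u : vertex (link X tau) | edge u v)
     #|top_faces (tau :|: [set val u; val v])|%:R * g (val u)
  = \sum_(s in top_faces (tau :|: [set val v]))
      \sum_(u in s :\: (tau :|: [set val v])) g u.
Proof.
rewrite -sum_top_facesU.
transitivity (\sum_(u : vertex (link X tau) |
    [set val u] \in faces (link X (tau :|: [set val v])) 1)
    \sum_(s in top_faces (tau :|: [set val v] :|: [set val u])) g (val u)).
  apply: eq_big => [u | u _]; first by rewrite link_vertexE link_edgeE.
  by rewrite sumr_const -[RHS]mulr_natl [ [set val u; val v] ]setUC setUA.
rewrite -(big_sub_cond (fun u => [set u] \in faces (link X tau) 1)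
  (fun u => [set u] \in faces (link X (tau :|: [set val v])) 1)
  (fun u => \sum_(s in top_faces (tau :|: [set val v] :|: [set u])) g u)).
apply: eq_bigl => u; rewrite unfold_in; apply: andb_idl.
rewrite !link_vertexE inE negb_or -andbA => /and3P[-> _ uX] /=.
by apply: (X_complex.2 _ _ uX); rewrite setUAC subsetUl.
Qed.

End LinkSums.

Section LinkGap.

Variables (R : realType) (V : finType) (n : nat) (X : {set {set V}}).
Hypotheses (X_complex : simplicial_complex X) (X_pure : pure n X).

Lemma walk_leigenvalue (tau : {set V}) (a : R)
    (y : vertex (link X tau) -> R) :
  (exists v, y v != 0) ->
  (forall v, \sum_(u | edge u v)
     (link_weight n X tau [set val u; val v])%:R
     / (link_weight n X tau [set val v])%:R * y u = a * y v) ->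
  passmx.leigenvalue (walk R n X tau) a.
Proof.
move=> [v yv] y_eig; apply/eqP => /vspaceP ker0.
pose f : {ffun vertex (link X tau) -> R^o} := [ffun u => y u].
have : f \in (0%VS : {vspace {ffun vertex (link X tau) -> R^o}}).
  rewrite -ker0 memv_ker !lfun_simp; apply/eqP/ffunP => u.
  rewrite /= !ffunE [X in _ - X](_ : _ = a * y u) // -y_eig; apply/eqP.
  by rewrite subr_eq0; apply/eqP; apply: eq_bigr => i _; rewrite ffunE.
rewrite memv0 => /eqP/ffunP/(_ v); rewrite !ffunE => yv0.
by rewrite yv0 eqxx in yv.
Qed.

Lemma link_gap (tau : {set V}) (lambda : R) :
  tau \in X -> (#|tau| < n)%N ->
  (forall u v, connect (@edge V (link X tau)) u v) -> 0 <= lambda ->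
  (forall a : R, passmx.leigenvalue (walk R n X tau) a ->
     a <= lambda \/ a = 1) ->
  forall phi : V -> R,
  \sum_(s in top_faces n X tau) \sum_(v in s :\: tau) phi v = 0 ->
  \sum_(s in top_faces n X tau) \sum_(v in s :\: tau)
     \sum_(u in s :\: (tau :|: [set v])) phi v * phi u <=
  lambda * (n - #|tau|)%:R *
    \sum_(s in top_faces n X tau) \sum_(v in s :\: tau) phi v ^+ 2.
Proof.
move=> tauX tau_n conn lambda_ge0 spec phi phi0.
pose N (s : {set V}) : R := #|top_faces n X s|%:R.
pose c (v u : vertex (link X tau)) : R :=
  if edge u v then N (tau :|: [set val u; val v]) else 0.
pose k : R := (n - #|tau|)%:R.
pose w (v : vertex (link X tau)) : R := k * N (tau :|: [set val v]).
have k_gt0 : 0 < k by rewrite ltr0n subn_gt0.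
have vP (v : vertex (link X tau)) :
    [/\ val v \notin tau & tau :|: [set val v] \in X].
  by apply/andP; rewrite -(link_vertexE X_complex); exact: valP v.
have N_gt0 (v : vertex (link X tau)) : 0 < N (tau :|: [set val v]).
  by rewrite ltr0n top_faces_gt0 //; case: (vP v).
have edgeC (u v : vertex (link X tau)) : edge u v = edge v u :> bool.
  by rewrite /edge [ [set val u; val v] ]setUC.
have cE (g : V -> R) v : \sum_u c v u * g (val u) =
    \sum_(s in top_faces n X (tau :|: [set val v]))
      \sum_(u in s :\: (tau :|: [set val v])) g u.
  rewrite -sum_link_neighbours // [RHS]big_mkcond; apply: eq_bigr => u _.
  by rewrite /c; case: ifP => _; rewrite ?mul0r.
have tau_v_card (v : vertex (link X tau)) : #|tau :|: [set val v]| = #|tau|.+1.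
  by case: (vP v) => vt _; rewrite setUC cardsU1 vt.
have wE v : w v = \sum_u c v u.
  transitivity (\sum_u c v u * 1); last by under eq_bigr do rewrite mulr1.
  rewrite (cE (fun=> 1)).
  have card_s s : s \in top_faces n X (tau :|: [set val v]) ->
      \sum_(u in s :\: (tau :|: [set val v])) 1 = k :> R.
    case/top_facesP => sX s_card tvs.
    by rewrite sumr_const cardsD (setIidPr tvs) s_card tau_v_card subSS.
  by rewrite (eq_bigr _ card_s) sumr_const /w -mulr_natr.
have weightE (v : vertex (link X tau)) : (link_weight n X tau [set val v])%:R =
    (n - #|tau|.+1)`!%:R * w v.
  rewrite /link_weight /weight tau_v_card subSS /w mulrA -natrM -natrM.
  have -> : (n - #|tau|)`! = ((n - #|tau|.+1)`! * (n - #|tau|))%N.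
    by rewrite subnS -{1}(prednK (n := n - #|tau|)) ?subn_gt0 // factS prednK
      ?subn_gt0 // mulnC.
  by rewrite mulnC.
have edge_weightE (u v : vertex (link X tau)) : edge u v ->
    (link_weight n X tau [set val u; val v])%:R = (n - #|tau|.+1)`!%:R * c v u.
  move=> uv; rewrite /c uv /link_weight /weight -natrM; congr (_`! * _)%:R.
  move: uv; rewrite (link_edgeE X_complex) => /andP[u_notin _].
  by rewrite [ [set val u; val v] ]setUC setUA setUC cardsU1 u_notin tau_v_card subSS.
have w_gt0 v : 0 < w v by rewrite mulr_gt0.
have eig (a : R) (y : vertex (link X tau) -> R) : (exists v, y v != 0) ->
    (forall v, \sum_u c v u * y u = a * (w v * y v)) -> a <= lambda \/ a = 1.
  move=> y0 y_eig; apply: spec; apply: (walk_leigenvalue y0) => v.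
  apply: (mulfI (lt0r_neq0 (w_gt0 v))); rewrite mulrCA -y_eig mulr_sumr.
  rewrite big_mkcond; apply: eq_bigr => u _; case: ifP => uv; last first.
    by rewrite /c uv mul0r.
  rewrite edge_weightE // weightE; field.
  by rewrite lt0r_neq0 //= pnatr_eq0 -lt0n fact_gt0.
have c_sym u v : c u v = c v u.
  by rewrite /c edgeC [ [set val u; val v] ]setUC.
have c_ge0 u v : 0 <= c u v by rewrite /c; case: ifP.
have c_conn u v : connect (fun u v => c u v != 0) u v.
  rewrite (eq_connect (e' := @edge V (link X tau))) // => x y.
  rewrite /c edgeC; case: ifP => [xy|_]; rewrite ?eqxx // pnatr_eq0 -lt0n.
  apply: top_faces_gt0 => //; move: xy; rewrite (link_edgeE X_complex).
  by rewrite -setUA => /andP[].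
have sum_w (g : V -> R) : \sum_v w v * g (val v) =
    k * \sum_(s in top_faces n X tau) \sum_(v in s :\: tau) g v.
  rewrite -(sum_link_vertices n X_complex) mulr_sumr; apply: eq_bigr => v _.
  by rewrite sumr_const -mulrA; congr (k * _); rewrite mulr_natl.
have := reversible_gap c_sym c_ge0 wE w_gt0 c_conn lambda_ge0 eig
  (phi := fun v => phi (val v)).
rewrite sum_w phi0 mulr0 => /(_ erefl); rewrite -mulrA.
rewrite (sum_w (fun v => phi v ^+ 2)); congr (_ <= _).
rewrite -(sum_link_vertices n X_complex); apply: eq_bigr => v _.
under eq_bigr do rewrite -mulrA mulrCA.
rewrite -mulr_sumr cE mulr_sumr; apply: eq_bigr => s _.
by rewrite mulr_sumr.
Qed.

End LinkGap.

(* #|T| times the covariance for the uniform probability on T. *)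
Definition cov (R : realFieldType) (I : finType) (T : {set I}) (a b : I -> R) : R :=
  \sum_(s in T) a s * b s
  - (\sum_(s in T) a s) * (\sum_(s in T) b s) / #|T|%:R.

Lemma cov_centered (R : realFieldType) (I : finType) (T : {set I}) (a b : I -> R) :
  (0 < #|T|)%N ->
  cov T a b = \sum_(s in T) (a s - (\sum_(s in T) a s) / #|T|%:R)
                          * (b s - (\sum_(s in T) b s) / #|T|%:R).
Proof.
move=> T_gt0; have N_neq0 : #|T|%:R != 0 :> R by rewrite pnatr_eq0 -lt0n.
rewrite /cov; set A := \sum_(s in T) a s; set B := \sum_(s in T) b s.
rewrite [RHS](eq_bigr (fun s => a s * b s - a s * (B / #|T|%:R)
  - A / #|T|%:R * b s + A / #|T|%:R * (B / #|T|%:R))); last first.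
  by move=> s _; ring.
rewrite big_split !sumrB /= -mulr_suml -mulr_sumr sumr_const -mulr_natl -/A -/B.
by field.
Qed.

Lemma sum_sqr_ge (R : realFieldType) (I : finType) (T : {set I}) (a : I -> R) :
  (\sum_(s in T) a s) ^+ 2 / #|T|%:R <= \sum_(s in T) a s ^+ 2.
Proof.
have [T0 | T_gt0] := posnP #|T|.
  by rewrite T0 invr0 mulr0 sumr_ge0 // => s _; rewrite sqr_ge0.
rewrite -subr_ge0.
have -> : \sum_(s in T) a s ^+ 2 - (\sum_(s in T) a s) ^+ 2 / #|T|%:R = cov T a a.
  by rewrite /cov expr2; congr (_ - _); apply: eq_bigr.
by rewrite cov_centered // sumr_ge0 // => s _; rewrite -expr2 sqr_ge0.
Qed.

Lemma le_sqrt_of_scaled (R : rcfType) (m a b c : R) :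
  0 <= m -> 0 <= a -> 0 <= b ->
  (forall t, 2 * t * c <= m * (t ^+ 2 * a + b)) -> `|c| <= m * Num.sqrt (a * b).
Proof.
move=> m_ge0 a_ge0 b_ge0 scaled.
rewrite -sqrtr_sqr -(ger0_norm m_ge0) -sqrtr_sqr -sqrtrM ?sqr_ge0 //.
apply: ler_wsqrtr.
have [ma0 | ma_neq0] := eqVneq (m * a) 0.
  have [-> | c_neq0] := eqVneq c 0; first by rewrite expr0n mulr_ge0 ?sqr_ge0 ?mulr_ge0.
  have := scaled ((m * b + 1) / (2 * c)).
  have -> : 2 * ((m * b + 1) / (2 * c)) * c = m * b + 1 by field.
  by rewrite mulrDr mulrCA ma0 mulr0 add0r gerDl ler10.
have /andP[m_neq0 a_neq0] : (m != 0) && (a != 0) by rewrite -negb_or -mulf_eq0.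
have ma_gt0 : 0 < m * a by rewrite lt0r ma_neq0 mulr_ge0.
have := scaled (c / (m * a)).
rewrite -(ler_pM2l ma_gt0).
have -> : m * a * (2 * (c / (m * a)) * c) = 2 * c ^+ 2 by field; rewrite m_neq0 a_neq0.
have -> : m * a * (m * ((c / (m * a)) ^+ 2 * a + b)) = c ^+ 2 + m ^+ 2 * (a * b).
  by field; rewrite m_neq0 a_neq0.
lra.
Qed.

Lemma le_sqrtr (R : rcfType) (x : R) : 0 <= x -> x <= 1 -> x <= Num.sqrt x.
Proof.
move=> x_ge0 x_le1; rewrite -{1}(sqr_sqrtr x_ge0) expr2.
by rewrite ler_piMr ?sqrtr_ge0 // -[leRHS]sqrtr1 ler_wsqrtr.
Qed.

Section ColorCovariance.

Variables (R : realType) (V : finType) (n : nat) (X : {set {set V}}).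
Variables (S : 'I_n.+1 -> {set V}) (lambda : R).
Hypotheses (X_complex : simplicial_complex X) (X_pure : pure n X).
Hypotheses (X_partite : partite X S) (lambda_ge0 : 0 <= lambda).
Hypothesis X_gap : forall (tau : {set V}), tau \in X -> (#|tau| < n)%N ->
  forall phi : V -> R,
  \sum_(s in top_faces n X tau) \sum_(v in s :\: tau) phi v = 0 ->
  \sum_(s in top_faces n X tau) \sum_(v in s :\: tau)
     \sum_(u in s :\: (tau :|: [set v])) phi v * phi u <=
  lambda * (n - #|tau|)%:R *
    \sum_(s in top_faces n X tau) \sum_(v in s :\: tau) phi v ^+ 2.

Definition supported (i : 'I_n.+1) (f : V -> R) : Prop :=
  forall v, v \notin S i -> f v = 0.

(* For f supported on S i, the value of f at the vertex of s in S i. *)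
Definition at_face (f : V -> R) (s : {set V}) : R := \sum_(v in s) f v.

Lemma color_vertex (tau s : {set V}) (i : 'I_n.+1) :
  s \in top_faces n X tau -> exists v, s :&: S i = [set v].
Proof.
case: X_partite => _ _ one; rewrite inE => /andP[s_top _].
by have /eqP/cards1P[v ->] := one s i s_top; exists v.
Qed.

Lemma colors_disjoint (i j : 'I_n.+1) v : i != j -> v \in S i -> v \notin S j.
Proof.
by case: X_partite => dis _ _ ij vi; rewrite (disjointFr (dis i j ij) vi).
Qed.

Lemma sum_supported (tau s : {set V}) (i : 'I_n.+1) (f : V -> R) v :
  supported i f -> [disjoint tau & S i] -> s :&: S i = [set v] ->
  \sum_(u in s :\: tau) f u = f v.
Proof.
move=> fi tau_i sv.
have /setIP[vs vi] : v \in s :&: S i by rewrite sv set11.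
have v_notin : v \notin tau by rewrite (disjointFl tau_i vi).
rewrite (bigD1 v) /= ?inE ?v_notin // big1 ?addr0 // => u.
rewrite inE => /andP[/andP[_ us] uv]; apply: fi; apply: contra uv => ui.
by rewrite -in_set1 -sv inE us.
Qed.

Lemma at_face_supported (s : {set V}) (i : 'I_n.+1) (f : V -> R) v :
  supported i f -> s :&: S i = [set v] -> at_face f s = f v.
Proof.
move=> fi sv; rewrite /at_face -(setD0 s) (sum_supported fi _ sv) //.
by rewrite disjoint_sym disjoints_subset setC0 subsetT.
Qed.

Lemma cov_link_colors (tau : {set V}) (i j : 'I_n.+1) (f h : V -> R) :
  tau \in X -> (#|tau| < n)%N -> i != j ->
  [disjoint tau & S i] -> [disjoint tau & S j] ->
  supported i f -> supported j h ->
  2 * cov (top_faces n X tau) (at_face f) (at_face h) <=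
  n%:R * lambda * (\sum_(s in top_faces n X tau) at_face f s ^+ 2
                 + \sum_(s in top_faces n X tau) at_face h s ^+ 2).
Proof.
move=> tauX tau_n ij tau_i tau_j fi hj.
have T_gt0 := top_faces_gt0 X_pure tauX.
have N_neq0 : #|top_faces n X tau|%:R != 0 :> R by rewrite pnatr_eq0 -lt0n.
rewrite cov_centered //; set T := top_faces n X tau.
set mf := _ / _; set mh := _ / #|T|%:R.
pose f1 v := if v \in S i then f v - mf else 0.
pose h1 v := if v \in S j then h v - mh else 0.
have f1i : supported i f1 by move=> v; rewrite /f1 => /negPf ->.
have h1j : supported j h1 by move=> v; rewrite /h1 => /negPf ->.
have sum_center (a : {set V} -> R) :
    \sum_(s in T) (a s - (\sum_(s in T) a s) / #|T|%:R) = 0.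
  by rewrite sumrB sumr_const -[X in _ - X]mulr_natr divfK ?subrr.
have main s : s \in T ->
  [/\ \sum_(v in s :\: tau) (f1 v + h1 v) =
        (at_face f s - mf) + (at_face h s - mh),
      \sum_(v in s :\: tau) (f1 v + h1 v) ^+ 2 =
        (at_face f s - mf) ^+ 2 + (at_face h s - mh) ^+ 2 &
      \sum_(v in s :\: tau) \sum_(u in s :\: (tau :|: [set v]))
         (f1 v + h1 v) * (f1 u + h1 u) =
      2 * ((at_face f s - mf) * (at_face h s - mh))].
  move=> sT; have [x sx] := color_vertex i sT; have [y sy] := color_vertex j sT.
  have /setIP[_ xi] : x \in s :&: S i by rewrite sx set11.
  have /setIP[_ yj] : y \in s :&: S j by rewrite sy set11.
  rewrite (at_face_supported fi sx) (at_face_supported hj sy).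
  have e1 : \sum_(v in s :\: tau) (f1 v + h1 v) = (f x - mf) + (h y - mh).
    rewrite big_split /= (sum_supported f1i _ sx) // (sum_supported h1j _ sy) //.
    by rewrite /f1 /h1 xi yj.
  have e2 : \sum_(v in s :\: tau) (f1 v + h1 v) ^+ 2 =
      (f x - mf) ^+ 2 + (h y - mh) ^+ 2.
    have -> : \sum_(v in s :\: tau) (f1 v + h1 v) ^+ 2 =
      \sum_(v in s :\: tau) f1 v ^+ 2 + \sum_(v in s :\: tau) h1 v ^+ 2.
      rewrite -big_split; apply: eq_bigr => v _ /=.
      rewrite /f1 /h1; case: ifP => [vi|_]; last by ring.
      by rewrite (negPf (colors_disjoint ij vi)); ring.
    rewrite (sum_supported (i := i) (f := fun v => f1 v ^+ 2) _ _ sx) //; last first.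
      by move=> v /f1i ->; rewrite expr0n.
    rewrite (sum_supported (i := j) (f := fun v => h1 v ^+ 2) _ _ sy) //; last first.
      by move=> v /h1j ->; rewrite expr0n.
    by rewrite /f1 /h1 xi yj.
  split=> //.
  transitivity ((\sum_(v in s :\: tau) (f1 v + h1 v)) ^+ 2
      - \sum_(v in s :\: tau) (f1 v + h1 v) ^+ 2); last by rewrite e1 e2; ring.
  rewrite expr2 mulr_suml -sumrB; apply: eq_bigr => v v_in.
  rewrite -mulr_sumr expr2 -mulrBr [in RHS](bigD1 v) //= addrC addrK.
  congr (_ * _); apply: eq_bigl => u.
  by rewrite !inE negb_or andbAC.
have := X_gap tauX tau_n (phi := fun v => f1 v + h1 v).
have -> : \sum_(s in top_faces n X tau) \sum_(v in s :\: tau) (f1 v + h1 v) = 0.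
  rewrite (eq_bigr (fun s => (at_face f s - mf) + (at_face h s - mh))).
    by rewrite big_split /= !sum_center addr0.
  by move=> s /main[].
move=> /(_ erefl).
rewrite (eq_bigr (fun s => 2 * ((at_face f s - mf) * (at_face h s - mh))));
  last first.
  by move=> s /main[].
rewrite -mulr_sumr => /le_trans; apply.
rewrite (eq_bigr (fun s => (at_face f s - mf) ^+ 2 + (at_face h s - mh) ^+ 2)); last first.
  by move=> s /main[].
have var_le (a : {set V} -> R) :
    \sum_(s in T) (a s - (\sum_(s in T) a s) / #|T|%:R) ^+ 2 <= \sum_(s in T) a s ^+ 2.
  have -> : \sum_(s in T) (a s - (\sum_(s in T) a s) / #|T|%:R) ^+ 2 = cov T a a.
    by rewrite cov_centered //; apply: eq_bigr => s _; rewrite expr2.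
  rewrite /cov -[leRHS]subr0; apply: lerB; last by rewrite -expr2 divr_ge0 ?sqr_ge0.
  by apply: ler_sum => s _; rewrite expr2.
rewrite big_split /=; apply: ler_pM.
- by rewrite mulr_ge0.
- by rewrite addr_ge0 // sumr_ge0 // => s _; rewrite sqr_ge0.
- by rewrite mulrC ler_wpM2r // ler_nat leq_subr.
- by rewrite lerD // var_le.
Qed.

Lemma top_facesU1 (tau s : {set V}) v :
  (s \in top_faces n X (tau :|: [set v])) = (s \in top_faces n X tau) && (v \in s).
Proof. by rewrite !inE subUset sub1set andbA. Qed.

Lemma sum_color (tau : {set V}) (j : 'I_n.+1) (g : {set V} -> R) :
  \sum_(s in top_faces n X tau) g s =
  \sum_(v in S j) \sum_(s in top_faces n X (tau :|: [set v])) g s.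
Proof.
rewrite (exchange_big_dep (mem (top_faces n X tau))) /=; last first.
  by move=> v s _; rewrite top_facesU1 => /andP[].
apply: eq_bigr => s sT; have [x sx] := color_vertex j sT.
rewrite (big_pred1 x) // => v.
by rewrite top_facesU1 sT /= andbC -in_setI sx in_set1.
Qed.

Lemma free_color (tau : {set V}) (i : 'I_n.+1) :
  tau \in X -> (#|tau| < n)%N ->
  exists2 j, i != j & [disjoint tau & S j].
Proof.
move=> tauX tau_n; apply/exists_inP; apply: contraLR tau_n => /exists_inPn no_free.
have /card_gt0P[s sT] := top_faces_gt0 X_pure tauX.
have [x sx] := color_vertex i sT.
have /top_facesP[sX s_card tau_s] := sT.
have x_in : x \in s by have /setIP[] : x \in s :&: S i by rewrite sx set11.
rewrite -leqNgt; have -> : n = #|s :\ x|.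
  by apply/eqP; rewrite -eqSS -s_card (cardsD1 x) x_in.
apply/subset_leq_card/subsetP => v; rewrite !inE => /andP[vx vs].
case: X_partite => _ cover _.
have : v \in [set v : V | [set v] \in faces X 1].
  by rewrite !inE cards1 eqxx andbT (X_complex.2 _ _ sX) // sub1set.
rewrite cover => /bigcupP[j _ vj].
have ij : i != j.
  apply: contra vx => /eqP ij; rewrite -in_set1 -sx inE vs.
  by rewrite ij.
have := no_free j ij; rewrite disjoint_subset => /subsetPn[u ut].
rewrite inE negbK => uj.
have [y sy] := color_vertex j sT.
have /set1P -> : v \in [set y] by rewrite -sy inE vs.
have /set1P <- : u \in [set y] by rewrite -sy inE (subsetP tau_s).
exact: ut.
Qed.

(* Conditioning on the vertex of color j splits the covariance into the average
   of the conditional covariances and the covariance with the conditional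
   expectation of F, which depends on that vertex only. *)
Lemma cov_color_rest (tau : {set V}) (i : 'I_n.+1) (f : V -> R)
    (F : {set V} -> R) :
  tau \in X -> (#|tau| <= n)%N -> [disjoint tau & S i] -> supported i f ->
  2 * cov (top_faces n X tau) (at_face f) (fun s => F (s :\: S i)) <=
  (n - #|tau|)%:R * (n%:R * lambda) *
   (\sum_(s in top_faces n X tau) at_face f s ^+ 2
    + \sum_(s in top_faces n X tau) F (s :\: S i) ^+ 2).
Proof.
move=> + tau_n + fi; move: tau_n; move Ed: (n - #|tau|)%N => d.
elim: d tau Ed => [|d IHd] tau Ed tau_n tauX tau_i.
  have tau_card : #|tau| = n by apply/eqP; rewrite eqn_leq tau_n -subn_eq0 Ed.
  have rest s : s \in top_faces n X tau -> s :\: S i = tau.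
    move=> sT; have [x sx] := color_vertex i sT.
    have /top_facesP[sX s_card tau_s] := sT.
    apply/esym/eqP; rewrite eqEcard subsetD tau_s tau_i /= cardsD sx cards1.
    by rewrite s_card tau_card subn1.
  have T_gt0 := top_faces_gt0 X_pure tauX.
  have N_neq0 : #|top_faces n X tau|%:R != 0 :> R by rewrite pnatr_eq0 -lt0n.
  rewrite mul0r mul0r /cov.
  rewrite (eq_bigr (fun s => at_face f s * F tau)); last by move=> s /rest ->.
  rewrite [X in _ - _ * X / _](eq_bigr (fun=> F tau)); last by move=> s /rest ->.
  rewrite sumr_const -mulr_suml -[F tau *+ _]mulr_natr mulrA mulfK // subrr.
  by rewrite mulr0.
have {}tau_n : (#|tau| < n)%N by rewrite -subn_gt0 Ed.
have [j ij tau_j] := free_color i tauX tau_n.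
pose T s := top_faces n X s; rewrite -/(T tau).
pose N s : R := #|T s|%:R.
pose G s := F (s :\: S i).
pose h v := if v \in S j then
  (\sum_(s in T (tau :|: [set v])) G s) / N (tau :|: [set v]) else 0.
have hj : supported j h by move=> v; rewrite /h => /negPf ->.
have hE v s : v \in S j -> s \in T (tau :|: [set v]) -> at_face h s = h v.
  move=> vj sT; have [y sy] := color_vertex j sT.
  rewrite (at_face_supported hj sy); congr h; apply/esym/set1P; rewrite -sy inE vj.
  by move: sT; rewrite /T top_facesU1 => /andP[_ ->].
have N0 v g : N (tau :|: [set v]) = 0 ->
    \sum_(s in T (tau :|: [set v])) g s = 0 :> R.
  move=> /eqP; rewrite pnatr_eq0 cards_eq0 => /eqP ->; exact: big_set0.
have sum_h v : v \in S j -> h v * N (tau :|: [set v]) =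
    \sum_(s in T (tau :|: [set v])) G s.
  move=> vj; rewrite /h vj; have [/[dup]/N0-> ->|N_neq0] :=
    eqVneq (N (tau :|: [set v])) 0.
    by rewrite mulr0.
  by rewrite divfK.
have cov_split : cov (T tau) (at_face f) G =
    \sum_(v in S j) cov (T (tau :|: [set v])) (at_face f) G
    + cov (T tau) (at_face f) (at_face h).
  rewrite /cov sumrB -!(sum_color _ j).
  have -> : \sum_(s in T tau) at_face h s = \sum_(s in T tau) G s.
    rewrite /T 2!(sum_color tau j); apply: eq_bigr => v vj.
    rewrite (eq_bigr (fun=> h v)); last by move=> s; apply: hE.
    by rewrite sumr_const -mulr_natr sum_h.
  have -> : \sum_(s in T tau) at_face f s * at_face h s =
     \sum_(v in S j) (\sum_(s in T (tau :|: [set v])) at_face f s) *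
       (\sum_(s in T (tau :|: [set v])) G s) / #|T (tau :|: [set v])|%:R.
    rewrite /T (sum_color tau j); apply: eq_bigr => v vj.
    rewrite (eq_bigr (fun s => at_face f s * h v)); last first.
      by move=> s sT; rewrite (hE v).
    by rewrite -mulr_suml -mulrA; congr (_ * _); rewrite /h vj.
  by rewrite addrA subrK.
have h2_le : \sum_(s in T tau) at_face h s ^+ 2 <= \sum_(s in T tau) G s ^+ 2.
  rewrite /T 2!(sum_color tau j); apply: ler_sum => v vj.
  apply: le_trans (sum_sqr_ge _ _).
  rewrite (eq_bigr (fun=> h v ^+ 2)); last by move=> s sT; rewrite (hE v).
  rewrite -(sum_h v vj) sumr_const -[leLHS]mulr_natr -/(T _) -/(N _) exprMn.
  have [->|N_neq0] := eqVneq (N (tau :|: [set v])) 0; first by rewrite invr0 !mulr0.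
  by rewrite [N _ ^+ 2]expr2 mulrA mulfK.
have dS (m E : R) : d.+1%:R * m * E = d%:R * m * E + m * E.
  by rewrite -natr1; ring.
rewrite cov_split mulrDr mulr_sumr dS.
apply: lerD; last first.
  apply: le_trans (cov_link_colors tauX tau_n ij tau_i tau_j fi hj) _.
  by apply: ler_wpM2l; rewrite ?mulr_ge0 // lerD2l.
rewrite [X in _ * (X + _)](sum_color tau j) [X in _ * (_ + X)](sum_color tau j).
rewrite -big_split mulr_sumr; apply: ler_sum => v vj /=.
have v_tau : v \notin tau by rewrite (disjointFl tau_j vj).
have card_v : #|tau :|: [set v]| = #|tau|.+1 by rewrite setUC cardsU1 v_tau.
have [tvX | tvX] := boolP (tau :|: [set v] \in X).
  apply: IHd => //; first by rewrite card_v subnS Ed.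
    by rewrite card_v.
  rewrite -setI_eq0 setIUl setU_eq0 !setI_eq0 tau_i disjoints1 /=.
  by apply: colors_disjoint vj; rewrite eq_sym.
have T0 : T (tau :|: [set v]) = set0.
  apply/setP => s; rewrite in_set0; apply/negP => /top_facesP[sX _ ts].
  by rewrite (X_complex.2 _ _ sX) in tvX.
by rewrite /cov -/(T _) T0 !big_set0 mul0r mul0r subrr mulr0 addr0 mulr0.
Qed.

Variable U : 'I_n.+1 -> {set V}.
Hypothesis U_sub : forall i, U i \subset S i.

Let T := top_faces n X set0.
Definition hits (i : 'I_n.+1) (s : {set V}) : R := #|s :&: U i|%:R.
Definition hits_all (L : seq 'I_n.+1) (s : {set V}) : R := \prod_(i <- L) hits i s.
Definition avg (g : {set V} -> R) : R :=
  (\sum_(s in top_faces n X set0) g s) / #|top_faces n X set0|%:R.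

Let T_gt0 : 0 < #|T|%:R :> R.
Proof. by rewrite ltr0n (top_faces_gt0 X_pure) //; case: X_complex. Qed.

Lemma hitsE i s : hits i s = at_face (fun v => (v \in U i)%:R) s.
Proof.
rewrite /hits /at_face -sumr_const big_mkcond [RHS]big_mkcond.
apply: eq_bigr => v _; rewrite inE; by case: (v \in s); case: (v \in U i).
Qed.

Lemma hits_bool i s : s \in T -> exists b : bool, hits i s = b%:R.
Proof.
move=> sT; have [x sx] := color_vertex i sT; rewrite /hits.
have : (#|s :&: U i| <= 1)%N.
  by rewrite -(cards1 x) -sx subset_leq_card // setIS.
by case: #|_| => [|[|]] // _; [exists false | exists true].
Qed.

Lemma hits_all_bool L s : s \in T -> exists b : bool, hits_all L s = b%:R.
Proof.
move=> sT; rewrite /hits_all; elim: L => [|i L [b IHL]].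
  by exists true; rewrite big_nil.
have [c hc] := hits_bool i sT.
by exists (c && b); rewrite big_cons IHL hc -natrM mulnb.
Qed.

Lemma avg_bool (g : {set V} -> R) :
  (forall s, s \in T -> exists b : bool, g s = b%:R) ->
  avg (fun s => g s ^+ 2) = avg g /\ 0 <= avg g <= 1.
Proof.
move=> g_bool; have g01 s : s \in T -> g s ^+ 2 = g s /\ 0 <= g s <= 1.
  by move=> /g_bool[[] ->]; rewrite ?expr1n ?expr0n ler01 ?lexx.
split; first by congr (_ / _); apply: eq_bigr => s /g01[].
apply/andP; split.
  by rewrite /avg divr_ge0 // sumr_ge0 // => s /g01[_ /andP[]].
rewrite /avg ler_pdivrMr // mul1r -sumr_const ler_sum // => s /g01[_ /andP[]] //.
Qed.

Lemma avg_peel i L : i \notin L ->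
  `|avg (hits_all (i :: L)) - avg (hits i) * avg (hits_all L)| <=
  n%:R ^+ 2 * lambda * Num.sqrt (avg (hits i) * avg (hits_all L)).
Proof.
move=> iL; pose f v : R := (v \in U i)%:R.
have f_supp t : supported i (fun v => t * f v).
  move=> v vi; have /negPf vU : v \notin U i.
    by apply: contra vi; apply: (subsetP (U_sub i)).
  by rewrite /f vU mulr0.
have rest s : hits_all L (s :\: S i) = hits_all L s.
  rewrite /hits_all big_seq [RHS]big_seq; apply: eq_bigr => j jL.
  congr (#|pred_of_set _|%:R).
  apply/setP => v; rewrite !inE.
  case: (boolP (v \in U j)) => vj; rewrite ?andbF // !andbT.
  rewrite (colors_disjoint (i := j)) //; last exact: (subsetP (U_sub j)).
  by apply: contra iL => /eqP <-.
have [f2 f01] := avg_bool (@hits_bool i).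
have [F2 F01] := avg_bool (@hits_all_bool L).
apply: le_sqrt_of_scaled.
- by rewrite mulr_ge0 ?sqr_ge0.
- by case/andP: f01.
- by case/andP: F01.
move=> t.
have set0X : set0 \in X by case: X_complex.
have dis0 : [disjoint set0 & S i] by rewrite -setI_eq0 set0I.
have le_n : (#|@set0 V| <= n)%N by rewrite cards0.
have := cov_color_rest (hits_all L) set0X le_n dis0 (f_supp t).
rewrite cards0 subn0.
have at_t s : at_face (fun v => t * f v) s = t * hits i s.
  by rewrite hitsE /at_face mulr_sumr.
rewrite -/T -(ler_pM2r (x := #|T|%:R^-1)) ?invr_gt0 //.
have -> : 2 * cov T (at_face (fun v => t * f v))
      (fun s => hits_all L (s :\: S i)) / #|T|%:R =
  2 * t * (avg (hits_all (i :: L)) - avg (hits i) * avg (hits_all L)).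
  rewrite /cov /avg -/T.
  under eq_bigr do rewrite at_t rest -mulrA.
  under [X in _ - X * _ / _]eq_bigr do rewrite at_t.
  under [X in _ - _ * X / _]eq_bigr do rewrite rest.
  under [X in _ = _ * _ * (X / _ - _)]eq_bigr do
    rewrite /hits_all big_cons -/(hits_all L _).
  by rewrite -!mulr_sumr; field; rewrite lt0r_neq0.
have -> : n%:R * (n%:R * lambda) *
  (\sum_(s in T) at_face (fun v => t * f v) s ^+ 2 +
   \sum_(s in T) hits_all L (s :\: S i) ^+ 2) / #|T|%:R =
  n%:R ^+ 2 * lambda * (t ^+ 2 * avg (hits i) + avg (hits_all L)).
  rewrite -f2 -F2 /avg -/T.
  under eq_bigr do rewrite at_t exprMn.
  under [X in _ * (_ + X) / _]eq_bigr do rewrite rest.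
  by rewrite -!mulr_sumr; field; rewrite lt0r_neq0.
by [].
Qed.

Let P i := avg (hits i).
Let P01 i : 0 <= P i <= 1.
Proof. by have [] := avg_bool (@hits_bool i). Qed.
Let M := n%:R ^+ 2 * lambda.
Let M_ge0 : 0 <= M. Proof. by rewrite mulr_ge0 ?sqr_ge0. Qed.

Lemma avg_prod_le L : uniq L ->
  `|avg (hits_all L) - \prod_(i <- L) avg (hits i)| <= (size L)%:R * M.
Proof.
elim: L => [_|i L IHL /= /andP[iL L_uniq]].
  rewrite big_nil mul0r /avg -/T (eq_bigr (fun=> 1)) => [|s _]; last first.
    by rewrite /hits_all big_nil.
  by rewrite sumr_const divff ?subrr ?normr0 ?lt0r_neq0.
have [_ /andP[FL_ge0 FL_le1]] := avg_bool (@hits_all_bool L).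
have /andP[Pi_ge0 Pi_le1] := P01 i.
rewrite big_cons; have -> : (size L).+1%:R * M = M + (size L)%:R * M.
  by rewrite -natr1; ring.
have -> : avg (hits_all (i :: L)) - avg (hits i) * \prod_(j <- L) avg (hits j) =
  (avg (hits_all (i :: L)) - P i * avg (hits_all L))
  + P i * (avg (hits_all L) - \prod_(j <- L) avg (hits j)) by rewrite /P; ring.
apply: le_trans (ler_normD _ _) _; apply: lerD.
  apply: le_trans (avg_peel iL) _.
  by rewrite ler_piMr // -[leRHS]sqrtr1 ler_wsqrtr // mulr_ile1.
rewrite normrM ger0_norm //; apply: le_trans (IHL L_uniq).
by rewrite ler_piMl.
Qed.

Lemma avg_prod_pair_le p q : p != q ->
  `|avg (fun s => \prod_i hits i s) - \prod_i P i| <=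
  n.+1%:R * M * Num.sqrt (P p * P q).
Proof.
move=> pq; pose L := rem q (rem p (index_enum 'I_n.+1)).
have perm_L : perm_eq (index_enum 'I_n.+1) [:: p, q & L].
  apply: perm_trans (perm_to_rem (mem_index_enum p)) _; rewrite perm_cons.
  apply: perm_to_rem; rewrite mem_rem_uniq ?index_enum_uniq // inE eq_sym pq.
  exact: mem_index_enum.
have := perm_uniq perm_L; rewrite index_enum_uniq /= => /esym/and3P[pqL qL L_uniq].
have L_size : (size L).+2 = n.+1.
  have /= <- := perm_size perm_L.
  by rewrite -sum1_size sum1_card card_ord.
have -> : avg (fun s => \prod_i hits i s) = avg (hits_all [:: p, q & L]).
  by congr (_ / _); apply: eq_bigr => s _; apply: perm_big.
have -> : \prod_i P i = \prod_(i <- [:: p, q & L]) P i by apply: perm_big.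
have [_ /andP[FL_ge0 FL_le1]] := avg_bool (@hits_all_bool L).
have [_ /andP[FqL_ge0 FqL_le1]] := avg_bool (@hits_all_bool (q :: L)).
have /andP[Pp_ge0 Pp_le1] := P01 p; have /andP[Pq_ge0 Pq_le1] := P01 q.
have FqL_Pq : avg (hits_all (q :: L)) <= P q.
  rewrite ler_pM2r ?invr_gt0 //; apply: ler_sum => s sT.
  rewrite /hits_all big_cons -/(hits_all L s).
  have [b ->] := hits_bool q sT; have [c ->] := hits_all_bool L sT.
  by rewrite -natrM ler_nat mulnb; case: b; case: c.
set r := Num.sqrt (P p * P q).
have PpPq_le : P p * P q <= r.
  by apply: le_sqrtr; [apply: mulr_ge0 | apply: mulr_ile1].
have Ppr : P p * Num.sqrt (P q) <= r.
  by rewrite /r (sqrtrM (P q) Pp_ge0) ler_wpM2r ?sqrtr_ge0 // le_sqrtr.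
rewrite !big_cons.
have e1 := avg_peel pqL; have e2 := avg_peel qL; have e3 := avg_prod_le L_uniq.
have -> : avg (hits_all [:: p, q & L]) - P p * (P q * \prod_(i <- L) P i) =
  (avg (hits_all [:: p, q & L]) - P p * avg (hits_all (q :: L)))
  + P p * (avg (hits_all (q :: L)) - P q * avg (hits_all L))
  + P p * P q * (avg (hits_all L) - \prod_(i <- L) P i) by ring.
have -> : n.+1%:R * M * r = M * r + M * r + (size L)%:R * M * r.
  rewrite (_ : n.+1%:R = (size L).+2%:R :> R); last by rewrite L_size.
  by rewrite -!natr1; ring.
apply: le_trans (ler_normD _ _) _; apply: lerD.
  apply: le_trans (ler_normD _ _) _.
  apply: lerD.
    apply: le_trans e1 _; rewrite ler_wpM2l // ler_wsqrtr // ler_wpM2l //.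
  rewrite normrM ger0_norm //.
  apply: le_trans (ler_wpM2l Pp_ge0 e2) _.
  rewrite mulrCA ler_wpM2l //; apply: le_trans Ppr.
  by rewrite ler_wpM2l // ler_wsqrtr // ler_piMr.
have PpPq_ge0 : 0 <= P p * P q by apply: mulr_ge0.
by rewrite normrM (ger0_norm PpPq_ge0) mulrC; apply: ler_pM.
Qed.

End ColorCovariance.

Lemma top_faces0 (V : finType) (n : nat) (X : {set {set V}}) :
  top_faces n X set0 = faces X n.+1.
Proof. by apply/setP => s; rewrite inE sub0set andbT. Qed.

Lemma sum_cardI (V : finType) (T : {set {set V}}) (A : {set V}) (K : nat) :
  (forall v, v \in A -> #|[set s in T | v \in s]| = K) ->
  (\sum_(s in T) #|s :&: A| = #|A| * K)%N.
Proof.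
move=> regular; rewrite -sum_nat_const -(eq_bigr _ regular).
under eq_bigr do rewrite -sum1_card.
rewrite (exchange_big_dep (mem A)) /=; last by move=> s v _; rewrite inE => /andP[].
apply: eq_bigr => v vA; rewrite -sum1_card; apply: eq_bigl => s.
by rewrite !inE vA andbT.
Qed.

Lemma avg_hits (R : realType) (V : finType) (n : nat) (X : {set {set V}})
    (S U : 'I_n.+1 -> {set V}) (i : 'I_n.+1) :
  simplicial_complex X -> pure n X -> partite X S -> partite_regular X S ->
  U i \subset S i ->
  avg n X (hits R U i) = #|U i|%:R / #|S i|%:R.
Proof.
move=> X_complex X_pure [_ _ one] X_regular /subsetP U_sub.
have [K regK] := X_regular i.
have := sum_cardI regK.
rewrite (eq_bigr (fun=> 1%N)) => [|s s_top]; last exact: one.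
rewrite sum1_card => N_eq.
have : (0 < #|faces X n.+1|)%N.
  rewrite -top_faces0 top_faces_gt0 //; by case: X_complex.
rewrite N_eq muln_gt0 => /andP[Si_gt0 K_gt0].
rewrite /avg /hits top_faces0 -natr_sum (sum_cardI (K := K)) => [|v /U_sub/regK //].
by rewrite N_eq !natrM; field; rewrite !pnatr_eq0 -!lt0n Si_gt0.
Qed.

Lemma card_transversal_faces (R : realType) (V : finType) (n : nat)
    (X : {set {set V}}) (S U : 'I_n.+1 -> {set V}) :
  partite X S -> (forall i, U i \subset S i) ->
  #|transversal_faces X U|%:R =
  \sum_(s in faces X n.+1) \prod_i hits R U i s.
Proof.
move=> X_partite U_sub; rewrite -sum1_card natr_sum big_mkcond [RHS]big_mkcond.
apply: eq_bigr => s _; rewrite inE; case: (boolP (s \in _)) => //= s_top.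
have sT : s \in top_faces n X set0 by rewrite top_faces0.
case: ifP => [/forallP all1 | /negbT/forallPn[i s_i]].
  by rewrite big1 // => i _; rewrite /hits (eqP (all1 i)).
rewrite (bigD1 i) //=; have [b hb] := hits_bool R X_partite U_sub i sT.
rewrite hb; case: b hb => [/eqP|]; rewrite ?mul0r // eqr_nat.
by rewrite (negPf s_i).
Qed.

Lemma le_min_pairs (R : realType) (n : nat)
    (F : 'I_n.+1 -> 'I_n.+1 -> R) (x c : R) :
  (1 <= n)%N -> (forall p q, p != q -> x <= c * F p q) ->
  x <= c * min_pairs F.
Proof.
move=> n_ge1 x_le; rewrite /min_pairs.
apply: (big_ind (fun m => x <= c * m)) => [|m1 m2 x1 x2|[p q] /= pq].
- by apply: x_le; rewrite -val_eqE /= eq_sym -lt0n.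
- by rewrite minEle; case: ifP.
- by apply: x_le; rewrite -val_eqE /= ltn_eqF.
Qed.

Lemma mixing_const_ge (R : realType) (n : nat) : (1 <= n)%N ->
  n.+1%:R * n%:R ^+ 2 <= mixing_const R n.
Proof.
move=> n_ge1; rewrite /mixing_const big_ltn //.
apply: ler_wpDr.
  apply: sumr_ge0 => k _; apply: mulr_ge0.
    by rewrite mulr_ge0 // divr_ge0 // exprn_ge0.
  by rewrite exprS -mulrBr mulr_ge0 // subr_ge0 lerXn2r ?nnegrE ?ler_nat.
rewrite !subn0 mul1r expr1n.
have -> : n`!%:R = n%:R * (n - 1)`!%:R :> R.
  by case: n n_ge1 => // m _; rewrite factS natrM subn1.
have fact_neq0 : (n - 1)`!%:R != 0 :> R by rewrite pnatr_eq0 -lt0n fact_gt0.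
have -> : n%:R * (n - 1)`!%:R * (n.+1%:R ^+ n / (n - 1)`!%:R) * (2 ^+ n - 1) =
   n%:R * (n.+1%:R ^+ n * (2 ^+ n - 1)) :> R by field.
have -> : n.+1%:R * n%:R ^+ 2 = n%:R * (n.+1%:R * n%:R) :> R by ring.
rewrite ler_wpM2l // ler_pM // -?natrX ?ler_nat.
  by rewrite -{1}(expn1 n.+1) leq_exp2l.
by rewrite lerBrDr natr1 ler_nat ltn_expl.
Qed.

Theorem theorem1p2 (R : realType) (V : finType) (n : nat)
    (X : {set {set V}}) (S : 'I_n.+1 -> {set V}) (lambda : R)
    (n_ge1 : (1 <= n)%N)
    (X_complex : simplicial_complex X)
    (X_pure : pure n X)
    (X_connected : connected_links n X)
    (X_partite : partite X S)
    (X_regular : partite_regular X S)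
    (lambda_bounds : 0 < lambda < 1)
    (X_spectrum : forall tau : {set V}, tau \in X -> (#|tau| < n)%N ->
       forall a : R, passmx.leigenvalue (walk R n X tau) a ->
         -1 <= a <= lambda \/ a = 1)
    (U : 'I_n.+1 -> {set V})
    (U_sub : forall i : 'I_n.+1, U i \subset S i) :
  `| #|transversal_faces X U|%:R / #|faces X n.+1|%:R
     - (\prod_(i < n.+1) #|U i|%:R) / (\prod_(i < n.+1) #|S i|%:R) |
  <= mixing_const R n * lambda
     * min_pairs (fun i j : 'I_n.+1 =>
         Num.sqrt ((#|U i|%:R * #|U j|%:R) / (#|S i|%:R * #|S j|%:R))).
Proof.
have lambda_ge0 : 0 <= lambda by case/andP: lambda_bounds => /ltW.
apply: le_min_pairs => // p q pq.
have gap (tau : {set V}) (tauX : tau \in X) (tau_n : (#|tau| < n)%N) :=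
  link_gap X_complex X_pure tauX tau_n (X_connected tau tauX tau_n) lambda_ge0
    (fun a eig_a => match X_spectrum tau tauX tau_n a eig_a with
       | or_introl a_bounds => or_introl (proj2 (andP a_bounds))
       | or_intror a1 => or_intror a1 end).
have avgE i : avg n X (hits R U i) = #|U i|%:R / #|S i|%:R by apply: avg_hits.
have := avg_prod_pair_le X_complex X_pure X_partite lambda_ge0 gap U_sub pq.
rewrite !avgE (eq_bigr _ (fun i _ => avgE i)) prodf_div mulf_div.
rewrite {1}/avg top_faces0 -(card_transversal_faces R X_partite U_sub).
move=> /le_trans; apply; rewrite mulrA.
by rewrite ler_wpM2r ?sqrtr_ge0 // ler_wpM2r // mixing_const_ge.
Qed.
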